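(* Let $X$ and $Y$ be compact connected manifolds, let $\mathcal{A}_X\to X$ be a Lie algebroid of rank $2n$ and $\mathcal{A}_Y\to Y$ a Lie algebroid of rank $2n-2$, and let $(\varphi,f)\colon\mathcal{A}_X\to\mathcal{A}_Y$ be a Lie algebroid fibration. Assume that $Y$ is $\mathcal{A}_Y$-symplectic and that there exists a closed $\mathcal{A}_X$-two-form $\eta$ which is nondegenerate on $\ker\varphi$. Then $X$ admits an $\mathcal{A}_X$-symplectic structure.
   Context: A Lie algebroid over a manifold $X$ is a vector bundle $\mathcal{A}\to X$ with a Lie bracket on $\Gamma(\mathcal{A})$ and a vector bundle map $\rho_{\mathcal A}\colon \mathcal{A}\to TX$ (the anchor) with $[v,gw]_{\mathcal A}=g[v,w]_{\mathcal A}+(\mathcal{L}_{\rho_{\mathcal A}(v)}g)\,w$. The $\mathcal{A}$-forms $\Omega^\bullet_{\mathcal A}(X)=\Gamma(\wedge^\bullet\mathcal{A}^* )$ carry the differential $d_{\mathcal A}$ given by the Koszul formula; closed means $d_{\mathcal A}$-closed. An $\mathcal{A}$-symplectic structure on $X$ is a closed nondegenerate $\mathcal{A}$-two-form; $X$ is $\mathcal{A}$-symplectic if it admits one. A Lie algebroid morphism $(\varphi,f)\colon\mathcal{A}_X\to\mathcal{A}_Y$ is a vector bundle map $\varphi$ covering a smooth map $f\colon X\to Y$ such that $\varphi^*\colon\Omega^\bullet(\mathcal{A}_Y)\to\Omega^\bullet(\mathcal{A}_X)$ is a chain map. It is a Lie algebroid fibration if $\varphi$ is fiberwise surjective ($f$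 itself need not be a submersion). Standing convention: manifolds are orientable and not necessarily closed. *)

(* Defs.v *)
From HB Require Import structures.
From mathcomp Require Import all_boot all_order all_algebra.
From mathcomp Require Import all_classical all_reals all_analysis.
Set Implicit Arguments.
Unset Strict Implicit.
Unset Printing Implicit Defensive.
Import Order.TTheory GRing.Theory Num.Theory.
Import numFieldNormedType.Exports.
Local Open Scope classical_set_scope.
Local Open Scope ring_scope.

(* C^k on an open set [U] of R^m; only the values of [f] on [U] matter. *)
Fixpoint Ck {R : realType} {m : nat} (k : nat) (U : set 'rV[R]_m)
    (f : 'rV[R]_m -> R) : Prop :=
  match k with
  | 0 => forall x, U x -> {for x, continuous f}
  | k'.+1 => (forall x, U x -> differentiable f x) /\
             forall v : 'rV[R]_m, Ck k' U (fun x => 'D_v f x)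
  end.

(* Smoothness on an arbitrary subset [A] of R^m: local extendability to a
   C^oo function on an open subset of R^m.  It is used for sets [A] that are
   open in R^m (where it is plain C^oo) or relatively open in a half-space. *)
Definition smooth_in {R : realType} {m : nat} (A : set 'rV[R]_m)
    (f : 'rV[R]_m -> R) : Prop :=
  forall x, A x -> exists (U : set 'rV[R]_m) (g : 'rV[R]_m -> R),
    [/\ open U, U x, forall k, Ck k U g & forall y, U y -> A y -> f y = g y].

Definition half_space (R : realType) (m : nat) : set 'rV[R]_m :=
  [set x | forall i : 'I_m, val i = 0%N -> 0 <= x ord0 i].

(* [cinv] is only meaningful on [cmap @` cdom]. *)
Record chart (R : realType) (m : nat) (X : topologicalType) := Chart {
  cdom : set X;
  cmap : X -> 'rV[R]_m;
  cinv : 'rV[R]_m -> X;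
  cdom_open : open cdom;
  cmap_image : exists2 W : set 'rV[R]_m, open W &
    cmap @` cdom = W \/ cmap @` cdom = W `&` @half_space R m;
  cmapK : forall x, cdom x -> cinv (cmap x) = x;
  cmap_continuous : {within cdom, continuous cmap};
  cinv_continuous : {within cmap @` cdom, continuous cinv}
}.

(* Smooth m-manifold with (possibly empty) boundary, presented by an atlas. *)
Record manifold (R : realType) (m : nat) := Manifold {
  carrier :> topologicalType;
  atlas_idx : Type;
  atlas : atlas_idx -> chart R m carrier;
  manifold_hausdorff : hausdorff_space carrier;
  manifold_second_countable : @second_countable carrier;
  atlas_cover : forall x, exists c, cdom (atlas c) x;
  atlas_compatible : forall c c' (j : 'I_m),
    smooth_in (cmap (atlas c) @` (cdom (atlas c) `&` cdom (atlas c')))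
      (fun y => cmap (atlas c') (cinv (atlas c) y) ord0 j)
}.

Section Manifolds.
Context {R : realType} {m : nat} (X : manifold R m).

(* [U] is meant to be open. *)
Definition smooth_on (U : set X) (g : X -> R) : Prop :=
  forall c, smooth_in (cmap (atlas c) @` (U `&` cdom (atlas c)))
    (g \o cinv (atlas c)).

Definition smooth_near (x : X) (g : X -> R) : Prop :=
  exists U : set X, [/\ open U, U x & smooth_on U g].

Definition chart_coord (c : atlas_idx X) (i : 'I_m) : X -> R :=
  fun y => cmap (atlas c) y ord0 i.

(* Tangent vectors at [x] are the derivations of the algebra of germs at [x] of
   smooth functions; only the values of [D] on functions that are smooth near
   [x] matter. *)
Definition tangent (x : X) (D : (X -> R) -> R) : Prop :=
  [/\ forall g h, smooth_near x g -> smooth_near x h ->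
        (\forall y \near x, g y = h y) -> D g = D h,
      forall (a : R) g h, smooth_near x g -> smooth_near x h ->
        D (fun y => a * g y + h y) = a * D g + D h &
      forall g h, smooth_near x g -> smooth_near x h ->
        D (fun y => g y * h y) = g x * D h + h x * D g].

(* [s c x] is the sign of the chart [c] at [x] with respect to the orientation;
   [J] is forced to be the Jacobian matrix at [x] of the change of charts.
   Asking for a positively oriented atlas instead would wrongly exclude [0,1],
   because of the one-dimensional half-space charts at its endpoints. *)
Definition orientable : Prop :=
  exists s : atlas_idx X -> X -> R,
    (forall c x, cdom (atlas c) x ->
       (s c x = 1 \/ s c x = -1) /\ \forall y \near x, s c y = s c x) /\
    (forall c c' x, cdom (atlas c) x -> cdom (atlas c') x ->
     forall J : 'M[R]_m,
       (forall D, tangent x D -> forall j,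
          D (chart_coord c' j) = \sum_i J i j * D (chart_coord c i)) ->
       0 < s c x * s c' x * \det J).

End Manifolds.

Definition smooth_map {R : realType} {m p : nat} (X : manifold R m)
    (Y : manifold R p) (f : X -> Y) : Prop :=
  continuous f /\
  forall c (i : 'I_p),
    smooth_on (f @^-1` cdom (atlas c)) (fun x => chart_coord c i (f x)).

(* A vector bundle is given by its fibres together with a cover by local
   trivialisations whose transition matrices are smooth; this determines the
   smooth structure of the total space.  [triv t x] and [trivV t x] only matter
   for [x] in [tdom t]. *)
Record vbundle (R : realType) (m : nat) (X : manifold R m) (r : nat) :=
  VBundle {
  fiber :> X -> lmodType R;
  triv_idx : Type;
  tdom : triv_idx -> set X;
  triv : triv_idx -> forall x, fiber x -> 'rV[R]_r;
  trivV : triv_idx -> forall x, 'rV[R]_r -> fiber x;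
  tdom_open : forall t, open (tdom t);
  tdom_cover : forall x, exists t, tdom t x;
  triv_linear : forall t x, tdom t x -> linear (triv t (x := x));
  trivK : forall t x, tdom t x -> cancel (triv t (x := x)) (trivV t x);
  trivVK : forall t x, tdom t x -> cancel (trivV t x) (triv t (x := x));
  triv_compatible : forall t t' (i j : 'I_r),
    smooth_on (tdom t `&` tdom t')
      (fun x => triv t' (trivV t x (delta_mx ord0 i)) ord0 j)
}.

Section Bundles.
Context {R : realType} {m : nat} {X : manifold R m} {r : nat}.
Variable E : vbundle X r.

Definition frame (t : triv_idx E) (i : 'I_r) (x : X) : E x :=
  trivV t x (delta_mx ord0 i).

Definition smooth_section (v : forall x, E x) : Prop :=
  forall t (i : 'I_r), smooth_on (tdom t) (fun x => triv t (v x) ord0 i).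

(* [omega] is a smooth section of the k-th exterior power of the dual of [E]. *)
Definition is_form (k : nat) (omega : forall x, ('I_k -> E x) -> R) : Prop :=
  [/\ forall x (a : 'I_k -> E x) i (s : R) (u w : E x),
        omega x (dfwith a i (s *: u + w)) =
        s * omega x (dfwith a i u) + omega x (dfwith a i w),
      forall x (a : 'I_k -> E x) i j, i != j -> a i = a j -> omega x a = 0 &
      forall t (I : 'I_k -> 'I_r),
        smooth_on (tdom t) (fun x => omega x (fun l => frame t (I l) x))].

Definition zero_form (k : nat) : forall x, ('I_k -> E x) -> R :=
  fun _ _ => 0.

End Bundles.

Definition vec_of_seq {R : realType} {V : lmodType R} (k : nat) (s : seq V) :
  'I_k -> V := fun l => nth 0 s l.

(* Nondegeneracy of the restriction of [b] to [S]; [S := setT] for [b] itself. *)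
Definition nondegenerate_on {R : realType} {V : lmodType R} (S : set V)
    (b : ('I_2 -> V) -> R) : Prop :=
  forall u, S u -> (forall w, S w -> b (vec_of_seq [:: u; w]) = 0) -> u = 0.

(* [anchor x a g] is the derivative of [g] in the direction rho(a); the
   smoothness condition says that the matrix of the bundle map rho in local
   frames and local coordinates is smooth.  [bracket] only matters on smooth
   sections. *)
Record lie_algebroid (R : realType) (m : nat) (X : manifold R m) (r : nat) :=
  LieAlgebroid {
  bundle :> vbundle X r;
  anchor : forall x, bundle x -> (X -> R) -> R;
  bracket : (forall x, bundle x) -> (forall x, bundle x) ->
            forall x, bundle x;
  anchor_tangent : forall x (a : bundle x), tangent x (anchor a);
  anchor_linear : forall x (s : R) (a b : bundle x) g, smooth_near x g ->
    anchor (s *: a + b) g = s * anchor a g + anchor b g;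
  anchor_smooth : forall t (i : 'I_r) c (j : 'I_m),
    smooth_on (tdom t `&` cdom (atlas c))
      (fun x => anchor (frame (E := bundle) t i x) (chart_coord c j));
  bracket_smooth : forall v w,
    smooth_section v -> smooth_section w -> smooth_section (bracket v w);
  bracket_linear : forall (s : R) u v w,
    smooth_section u -> smooth_section v -> smooth_section w ->
    forall x, bracket (fun y => s *: u y + v y) w x =
              s *: bracket u w x + bracket v w x;
  bracket_skew : forall v w, smooth_section v -> smooth_section w ->
    forall x, bracket v w x = - bracket w v x;
  bracket_jacobi : forall u v w,
    smooth_section u -> smooth_section v -> smooth_section w ->
    forall x, bracket u (bracket v w) x + bracket v (bracket w u) x +
              bracket w (bracket u v) x = 0;
  bracket_leibniz : forall v w (g : X -> R),
    smooth_section v -> smooth_section w -> smooth_on setT g ->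
    forall x, bracket v (fun y => g y *: w y) x =
              g x *: bracket v w x + anchor (v x) g *: w x
}.

Section Differential.
Context {R : realType} {m : nat} {X : manifold R m} {r : nat}.
Variable A : lie_algebroid X r.

(* The right-hand side of the Koszul formula
   sum_i (-1)^i rho(v_i) (omega (v_0, ..^v_i.., v_k))
   + sum_(i < j) (-1)^(i+j)
       omega ([v_i, v_j], v_0, ..^v_i..^v_j.., v_k). *)
Definition koszul (k : nat) (omega : forall x, ('I_k -> A x) -> R)
    (v : 'I_k.+1 -> forall x, A x) (x : X) : R :=
  \sum_(i < k.+1) (-1) ^+ i *
     anchor (v i x) (fun y =>
       omega y (vec_of_seq [seq v l y | l <- enum 'I_k.+1 & l != i])) +
  \sum_(i < k.+1) \sum_(j < k.+1 | (i < j)%N) (-1) ^+ (i + j) *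
     omega x (vec_of_seq (bracket (v i) (v j) x ::
       [seq v l x | l <- enum 'I_k.+1 & (l != i) && (l != j)])).

(* The graph of d_A: by tensoriality of the Koszul formula, each k-form [omega]
   is in this relation with exactly one (k+1)-form [theta]. *)
Definition is_differential (k : nat) (omega : forall x, ('I_k -> A x) -> R)
    (theta : forall x, ('I_k.+1 -> A x) -> R) : Prop :=
  forall v : 'I_k.+1 -> forall x, A x, (forall i, smooth_section (v i)) ->
  forall x, theta x (fun i => v i x) = koszul omega v x.

Definition closed_form (k : nat) (omega : forall x, ('I_k -> A x) -> R) : Prop :=
  is_differential omega (@zero_form _ _ _ _ A k.+1).

Definition symplectic_form (omega : forall x, ('I_2 -> A x) -> R) : Prop :=
  [/\ is_form omega, closed_form omega &
      forall x, nondegenerate_on setT (omega x)].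

Definition admits_symplectic : Prop := exists omega, symplectic_form omega.

End Differential.

Section Morphisms.
Context {R : realType} {m p : nat} {X : manifold R m} {Y : manifold R p}.
Context {r q : nat}.

Definition pullback (E : vbundle X r) (F : vbundle Y q) (f : X -> Y)
    (phi : forall x, E x -> F (f x)) (k : nat)
    (omega : forall y, ('I_k -> F y) -> R) : forall x, ('I_k -> E x) -> R :=
  fun x a => omega (f x) (fun i => phi x (a i)).

Definition bundle_map (E : vbundle X r) (F : vbundle Y q) (f : X -> Y)
    (phi : forall x, E x -> F (f x)) : Prop :=
  [/\ smooth_map f, forall x, linear (phi x) &
      forall t t' (i : 'I_r) (j : 'I_q),
        smooth_on (tdom t `&` f @^-1` tdom t')
          (fun x => triv t' (phi x (frame t i x)) ord0 j)].

Definition algebroid_morphism (AX : lie_algebroid X r)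
    (AY : lie_algebroid Y q) (f : X -> Y)
    (phi : forall x, AX x -> AY (f x)) : Prop :=
  bundle_map phi /\
  forall k (omega : forall y, ('I_k -> AY y) -> R)
    (theta : forall y, ('I_k.+1 -> AY y) -> R),
    is_form omega -> is_form theta -> is_differential omega theta ->
    is_differential (pullback phi omega) (pullback phi theta).

Definition algebroid_fibration (AX : lie_algebroid X r)
    (AY : lie_algebroid Y q) (f : X -> Y)
    (phi : forall x, AX x -> AY (f x)) : Prop :=
  algebroid_morphism phi /\ forall x (b : AY (f x)), exists a, phi x a = b.

End Morphisms.

(* Main.v *)
Require Import Defs.
From HB Require Import structures.
From mathcomp Require Import all_boot all_order all_algebra.
From mathcomp Require Import ring.
From mathcomp Require Import all_classical all_reals all_analysis.
Set Implicit Arguments.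
Unset Strict Implicit.
Unset Printing Implicit Defensive.
Import Order.TTheory GRing.Theory Num.Theory.
Import numFieldNormedType.Exports.
Local Open Scope classical_set_scope.
Local Open Scope ring_scope.

(** The form is [e * eta + phi^* omega], where [omega] is a symplectic form of
    [AY] and [e] is a small positive number.  It is a closed two-form for every
    [e]: the pullback along a morphism of algebroids commutes with the
    differential, and the Koszul formula is linear in the form.  The substance is
    that it is nondegenerate once [e] is small.

    Fix a point and frames there.  Let [N] and [W] be the Gram matrices of [eta]
    and [omega], and [P] the matrix of [phi], acting on row vectors from the
    right.  The form has Gram matrix [e *: N + P *m W *m P^T], which degenerates
    as [e] tends to [0], so that its determinant alone says nothing.  One enlarges
    it to the saddle-point matrix
<<
      [ N     P W ]
      [ P^T   -e  ]
>>
    A vector [a] in the kernel of [e *: N + P *m W *m P^T] gives the vector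
    [(e a, a P W)] in the kernel of this matrix, so for [e != 0] it suffices that
    the latter be invertible ([saddle_mx_nondegenerate]).  Its advantage is that it
    is already invertible at [e = 0], precisely because [phi] is onto, [omega] is
    nondegenerate, and [eta] is nondegenerate on [ker phi] ([saddle_mx0_unit]).
    Its determinant depends continuously on the point and on [e], hence is nonzero
    for all points near a given one and all small [e] ([near_nondegenerate]), and
    compactness of [X] makes the bound on [e] uniform.

    The remaining work is the smooth calculus that these steps rely on.  Functions
    of class C^k on open sets of R^m are closed under sums, products and
    composition ([Ck_comp]); this passes to germs of smooth functions on a
    manifold, which may be read in any chart ([near_smooth_on]) and composed with
    smooth maps ([smooth_near_comp]); and a form evaluated on smooth sections is
    then smooth ([smooth_near_form]), which gives both the smoothness of the
    pullback and the linearity of the anchor terms of the Koszul formula. *)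

(** * Functions of class C^k on open subsets of R^m *)

Section SmoothRn.
Context {R : realType}.

(** The difference of the two functions vanishes near [x], hence is its own
    little-o remainder with differential [0]. *)
Lemma near_eq_differentiable {V W : normedModType R} (f g : V -> W) (x : V) :
  (\forall y \near x, f y = g y) -> differentiable f x -> differentiable g x.
Proof.
move=> fg df.
have dh : differentiable (g - f) x.
  have gf0 : \forall y \near x, (g - f) y = 0.
    by near=> y; rewrite !fctE (near fg y) ?subrr.
  have gfx := nbhs_singleton gf0.
  have gf_o : (g - f) \o shift x = cst ((g - f) x) + \0 +o_ 0 id.
    apply/eqaddoE; rewrite gfx addr0 funeqE => y /=.
    rewrite -[LHS]add0r; congr (_ + _); rewrite littleoE// => e e0.
    have : \forall z \near 0, (g - f) (z + x) = 0.
      rewrite (near_shift x); apply: filterS gf0 => z /=.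
      by rewrite sub0r subrK.
    by apply: filterS => z /= ->; rewrite normr0 mulr_ge0// ltW.
  have c0 : continuous (0 : V -> W) by exact: cst_continuous.
  have d0 : 'd (g - f) x = 0 :> (V -> W) by apply/diff_unique.
  by apply/diff_locallyP; rewrite d0.
have -> : g = f + (g - f) by rewrite addrCA subrr addr0.
exact: differentiableD.
Unshelve. all: by end_near. Qed.

Context {m : nat}.
Implicit Types (U : set 'rV[R]_m) (f g : 'rV[R]_m -> R).

Lemma Ck_eq k U f g : open U -> (forall x, U x -> f x = g x) ->
  Ck k U f -> Ck k U g.
Proof.
move=> oU; elim: k f g => [|k IH] f g fg /=.
  move=> fc x Ux; rewrite /prop_for /continuous_at -fg//.
  apply: cvg_trans (fc x Ux); apply: (@near_eq_cvg _ _ (nbhs x)).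
  by near=> y; apply: fg; near: y; exact: open_nbhs_nbhs.
have near_fg x : U x -> \forall y \near x, f y = g y.
  by move=> Ux; apply: filterS (open_nbhs_nbhs (conj oU Ux)) => y /fg.
case=> df Df; split=> [x Ux|v].
  exact: near_eq_differentiable (near_fg x Ux) (df x Ux).
apply: IH (Df v) => x Ux.
exact: near_eq_derive (near_fg x Ux).
Unshelve. all: by end_near. Qed.

Lemma Ck_subset k U V f : V `<=` U -> Ck k U f -> Ck k V f.
Proof.
move=> VU; elim: k f => [|k IH] f /=; first by move=> fc x /VU/fc.
by case=> df Df; split=> [x /VU/df//|v]; exact: IH.
Qed.

Lemma CkS k U f : Ck k.+1 U f -> Ck k U f.
Proof.
elim: k f => [|k IH] f [df Df] /=.
  by move=> x Ux; exact/differentiable_continuous/df.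
by split=> // v; exact: IH.
Qed.

Lemma Ck_cst k U (a : R) : Ck k U (fun=> a).
Proof.
elim: k a => [|k IH] a /=; first by move=> x _; exact: cst_continuous.
split=> [x _|v]; first exact: differentiable_cst.
by under eq_fun do rewrite derive_cst; exact: IH.
Qed.

Lemma CkD k U f g : open U -> Ck k U f -> Ck k U g -> Ck k U (f \+ g).
Proof.
move=> oU; elim: k f g => [|k IH] f g /=.
  by move=> fc gc x Ux; exact: continuousD (fc x Ux) (gc x Ux).
move=> [df Df] [dg Dg]; split=> [x Ux|v].
  exact: differentiableD (df x Ux) (dg x Ux).
apply: Ck_eq oU _ (IH _ _ (Df v) (Dg v)) => x Ux /=.
by rewrite deriveD//; apply: diff_derivable; [exact: df|exact: dg].
Qed.

Lemma CkM k U f g : open U -> Ck k U f -> Ck k U g -> Ck k U (f \* g).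
Proof.
move=> oU; elim: k f g => [|k IH] f g /=.
  by move=> fc gc x Ux; exact: continuousM (fc x Ux) (gc x Ux).
move=> Cf Cg; have [[df Df] [dg Dg]] := (Cf, Cg); split=> [x Ux|v].
  exact: differentiableM (df x Ux) (dg x Ux).
have := CkD oU (IH _ _ (CkS Cf) (Dg v)) (IH _ _ (CkS Cg) (Df v)).
apply: (Ck_eq oU) => x Ux /=.
by rewrite deriveM//; apply: diff_derivable; [exact: df|exact: dg].
Qed.

Lemma Ck_sum k U n (F : 'I_n -> 'rV[R]_m -> R) : open U ->
  (forall i, Ck k U (F i)) -> Ck k U (fun x => \sum_i F i x).
Proof.
move=> oU; elim: n F => [|n IH] F CF.
  by under eq_fun do rewrite big_ord0; exact: Ck_cst.
by under eq_fun do rewrite big_ord_recl; apply: CkD => //; exact: IH.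
Qed.

Let row_sum p (G : 'I_p -> 'rV[R]_m -> R) :
  (fun x => \row_j G j x) = \sum_j (fun x => G j x *: delta_mx 0 j).
Proof.
apply/funext => x; rewrite fct_sumE [LHS]row_sum_delta.
by apply: eq_bigr => j _; rewrite mxE.
Qed.

Lemma continuous_row p (G : 'I_p -> 'rV[R]_m -> R) (x : 'rV[R]_m) :
  (forall j, {for x, continuous (G j)}) ->
  {for x, continuous (fun y => \row_j G j y)}.
Proof.
move=> cG; rewrite row_sum; elim/big_ind: _ => [|a b ca cb|j _].
- exact: cst_continuous.
- exact: continuousD ca cb.
- exact: (continuousZr_tmp (cG j)).
Qed.

Lemma differentiable_row p (G : 'I_p -> 'rV[R]_m -> R) (x : 'rV[R]_m) :
  (forall j, differentiable (G j) x) ->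
  differentiable (fun y => \row_j G j y) x.
Proof.
move=> dG; rewrite row_sum; apply: differentiable_sum => j.
exact/differentiableZl/dG.
Qed.

(** The coordinatewise chain rule: ['D_v (h \o G)] is the sum of the products of
    ['D_v (G j)] with the partial derivatives of [h], pulled back along [G]; this
    is again built from functions of class C^k, which closes the induction. *)
Lemma Ck_comp k p U (V : set 'rV[R]_p) (h : 'rV[R]_p -> R)
    (G : 'I_p -> 'rV[R]_m -> R) : open U ->
  (forall x, U x -> V (\row_j G j x)) -> (forall j, Ck k U (G j)) ->
  Ck k V h -> Ck k U (fun x => h (\row_j G j x)).
Proof.
move=> oU GV; pose Gr x := \row_j G j x.
elim: k h => [|k IH] h CG /=.
  move=> hc x Ux; apply: (@continuous_comp _ _ _ Gr h); last exact/hc/GV.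
  by apply: continuous_row => j; exact: CG.
move=> [dh Dh].
have dG x j : U x -> differentiable (G j) x by case: (CG j) => + _; apply.
have dGr x : U x -> differentiable Gr x.
  by move=> Ux; apply: differentiable_row => j; exact: dG.
split=> [x Ux|v].
  exact: differentiable_comp (dGr x Ux) (dh _ (GV _ Ux)).
have CS : Ck k U (fun x => \sum_j 'D_v (G j) x * 'D_(delta_mx 0 j) h (Gr x)).
  apply: Ck_sum => // j; apply: CkM => //; first exact: (CG j).2.
  by apply: (IH (fun z => 'D_(delta_mx 0 j) h z)) => // i; exact: CkS.
apply: Ck_eq oU _ CS => x Ux.
have dhG := dh _ (GV _ Ux).
rewrite (deriveE _ (differentiable_comp (dGr x Ux) dhG)).
rewrite (diff_comp (dGr x Ux) dhG) /=.
rewrite -[X in 'd h _ X](deriveE v (dGr x Ux)) derive_mx; last first.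
  exact: diff_derivable (dGr x Ux).
rewrite [X in 'd h _ X]row_sum_delta linear_sum /=; apply: eq_bigr => j _.
rewrite linearZ /= (deriveE _ dhG) mxE.
by rewrite (_ : (fun t => Gr t 0 j) = G j)//; apply/funext => t; rewrite mxE.
Qed.

End SmoothRn.

(** * Smooth functions on arbitrary subsets of R^m *)

Section SmoothIn.
Context {R : realType} {m : nat}.
Implicit Types (A B : set 'rV[R]_m) (f g : 'rV[R]_m -> R).

Lemma smooth_in_eq A f g : (forall x, A x -> f x = g x) ->
  smooth_in A f -> smooth_in A g.
Proof.
move=> fg sf x Ax; have [U [h [oU Ux Ch fh]]] := sf x Ax.
by exists U, h; split=> // y Uy Ay; rewrite -fg// fh.
Qed.

Lemma smooth_in_subset A B f : B `<=` A -> smooth_in A f -> smooth_in B f.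
Proof.
move=> BA sf x Bx; have [U [h [oU Ux Ch fh]]] := sf x (BA _ Bx).
by exists U, h; split=> // y Uy /BA; exact: fh.
Qed.

Lemma smooth_in_cst A (a : R) : smooth_in A (fun=> a).
Proof.
move=> x _; exists setT, (fun=> a).
by split=> //; [exact: openT|move=> k; exact: Ck_cst].
Qed.

Lemma smooth_inD A f g : smooth_in A f -> smooth_in A g ->
  smooth_in A (fun x => f x + g x).
Proof.
move=> sf sg x Ax; have [U [f' [oU Ux Cf ff']]] := sf x Ax.
have [V [g' [oV Vx Cg gg']]] := sg x Ax; have oUV := openI oU oV.
exists (U `&` V), (f' \+ g'); split=> // [k|y [Uy Vy] Ay].
  by apply: CkD => //; [move: (Cf k)|move: (Cg k)]; apply: Ck_subset => y [].
by rewrite ff'// gg'.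
Qed.

Lemma smooth_inM A f g : smooth_in A f -> smooth_in A g ->
  smooth_in A (fun x => f x * g x).
Proof.
move=> sf sg x Ax; have [U [f' [oU Ux Cf ff']]] := sf x Ax.
have [V [g' [oV Vx Cg gg']]] := sg x Ax; have oUV := openI oU oV.
exists (U `&` V), (f' \* g'); split=> // [k|y [Uy Vy] Ay].
  by apply: CkM => //; [move: (Cf k)|move: (Cg k)]; apply: Ck_subset => y [].
by rewrite ff'// gg'.
Qed.

(** The local extension of [F] is restricted to the points that it sends into the
    domain of the local extension of [h]. *)
Lemma smooth_in_comp p A (B : set 'rV[R]_p) (F : 'rV[R]_m -> 'rV[R]_p)
    (h : 'rV[R]_p -> R) :
  (forall j, smooth_in A (fun x => F x ord0 j)) ->
  (forall x, A x -> B (F x)) -> smooth_in B h -> smooth_in A (h \o F).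
Proof.
move=> sF FB sh x Ax.
have [V [h' [oV VFx Ch hh']]] := sh _ (FB _ Ax).
have /choice[U] := fun j => sF j x Ax; move=> /choice[G UG].
have UGP j : [/\ open (U j), U j x, forall k, Ck k (U j) (G j) &
  forall y, U j y -> A y -> F y ord0 j = G j y] := UG j.
pose W0 := [set y | forall j, U j y].
have oW0 : open W0.
  rewrite openE => y Wy; suff : \forall z \near y, forall j, U j z by [].
  apply: (@filter_forall _ _ U (nbhs y) _) => j.
  by have [oUj _ _ _] := UGP j; exact: open_nbhs_nbhs.
pose Gr y := \row_j G j y.
have FG y : W0 y -> A y -> F y = Gr y.
  move=> Wy Ay; apply/rowP => j; rewrite mxE; have [_ _ _] := UGP j.
  by apply=> //; exact: Wy.
have CG k j : Ck k W0 (G j).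
  by have [_ _ /(_ k) + _] := UGP j; apply: Ck_subset => y; exact.
pose W := W0 `&` Gr @^-1` V.
have W0x : W0 x by move=> j; have [_] := UGP j.
have oW : open W.
  apply: ((continuous_inP Gr oW0).1 _ V oV) => y /set_mem Wy.
  by apply: continuous_row => j; exact: (CG 0%N j y Wy).
exists W, (h' \o Gr); split=> //.
- by split=> //=; rewrite -FG.
- move=> k; apply: (Ck_comp oW _ _ (Ch k)) => [y []//|j].
  by apply: Ck_subset (CG k j) => y [].
- move=> y [Wy Vy] Ay /=; have e := FG y Wy Ay.
  by rewrite hh'// ?e//; rewrite -e; exact: FB.
Qed.

End SmoothIn.

(** * Germs of smooth functions on a manifold *)

Section SmoothGerms.
Context {R : realType} {m : nat} {X : manifold R m}.
Implicit Types (U V : set X) (g h : X -> R) (x : X).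

Lemma smooth_on_subset U V g : V `<=` U -> smooth_on U g -> smooth_on V g.
Proof.
move=> VU sg c; apply: smooth_in_subset (sg c) => _ [y [Vy cy] <-].
by exists y => //; split=> //; exact: VU.
Qed.

Lemma smooth_on_eq U g h : (forall x, U x -> g x = h x) ->
  smooth_on U g -> smooth_on U h.
Proof.
move=> gh sg c; apply: smooth_in_eq (sg c) => _ [y [Uy cy] <-] /=.
by rewrite cmapK// gh.
Qed.

Lemma smooth_on_near U g x : open U -> smooth_on U g -> U x -> smooth_near x g.
Proof. by move=> oU sg Ux; exists U. Qed.

(** Since the inverse of a chart is continuous, a neighbourhood of [x] on which
    [g] is smooth contains all points of the chart whose coordinates are close to
    those of [x]. *)
Lemma near_smooth_on U g : (forall x, U x -> smooth_near x g) -> smooth_on U g.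
Proof.
move=> sg c _ [x [Ux cx] <-].
have [V [oV Vx sgV]] := sg x Ux.
have [W [h [oW Wx Ch gh]]] :
    exists (W : set 'rV[R]_m) (h : 'rV[R]_m -> R),
    [/\ open W, W (cmap (atlas c) x), forall k, Ck k W h &
     forall y, W y -> (cmap (atlas c) @` (V `&` cdom (atlas c))) y ->
       (g \o cinv (atlas c)) y = h y].
  by apply: sgV; exists x.
have Vc : nbhs (cinv (atlas c) (cmap (atlas c) x)) V.
  by rewrite cmapK//; exact: open_nbhs_nbhs.
have img_x : (cmap (atlas c) @` cdom (atlas c)) (cmap (atlas c) x) by exists x.
have := (subspace_continuousP _ _).1 (@cinv_continuous _ _ _ (atlas c)) _ img_x V Vc.
rewrite /= /within /= nbhsE => -[Q [oQ Qx] QV].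
exists (W `&` Q), h; split=> //; first exact: openI.
- by move=> k; apply: Ck_subset (Ch k) => y [].
- move=> y [Wy Qy] [x' [Ux' cx'] x'y]; apply: gh => //; exists x' => //; split=> //.
  by rewrite -(cmapK cx') x'y; apply: QV => //; exists x'.
Qed.

Lemma smooth_near_eq x g h : (\forall y \near x, g y = h y) ->
  smooth_near x g -> smooth_near x h.
Proof.
rewrite /prop_near1 nbhsE => -[U [oU Ux] gh] [V [oV Vx sg]].
exists (U `&` V); split=> //; first exact: openI.
apply: (smooth_on_eq (g := g)) => [y [/gh]//|].
by apply: smooth_on_subset sg => y [].
Qed.

Lemma smooth_near_cst x (a : R) : smooth_near x (fun=> a).
Proof.
by exists setT; split=> //; [exact: openT|move=> c; exact: smooth_in_cst].
Qed.

Lemma smooth_nearD x g h : smooth_near x g -> smooth_near x h ->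
  smooth_near x (fun y => g y + h y).
Proof.
move=> [U [oU Ux sg]] [V [oV Vx sh]].
exists (U `&` V); split=> //; first exact: openI.
move=> c; apply: smooth_inD.
- by apply: (smooth_on_subset _ sg) => y [].
- by apply: (smooth_on_subset _ sh) => y [].
Qed.

Lemma smooth_nearM x g h : smooth_near x g -> smooth_near x h ->
  smooth_near x (fun y => g y * h y).
Proof.
move=> [U [oU Ux sg]] [V [oV Vx sh]].
exists (U `&` V); split=> //; first exact: openI.
move=> c; apply: smooth_inM.
- by apply: (smooth_on_subset _ sg) => y [].
- by apply: (smooth_on_subset _ sh) => y [].
Qed.

Lemma smooth_near_sum x n (F : 'I_n -> X -> R) :
  (forall i, smooth_near x (F i)) -> smooth_near x (fun y => \sum_i F i y).
Proof.
elim: n F => [|n IH] F sF.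
  by under eq_fun do rewrite big_ord0; exact: smooth_near_cst.
under eq_fun do rewrite big_ord_recl.
by apply: smooth_nearD => //; exact: IH.
Qed.

Lemma smooth_near_continuous x g : smooth_near x g -> {for x, continuous g}.
Proof.
move=> [U [oU Ux sg]]; have [c cx] := atlas_cover x.
have oD : open (U `&` cdom (atlas c)) by apply: openI => //; exact: cdom_open.
have [W [h [oW Wx /(_ 0%N) Ch gh]]] :
    exists (W : set 'rV[R]_m) (h : 'rV[R]_m -> R),
    [/\ open W, W (cmap (atlas c) x), forall k, Ck k W h &
     forall y, W y -> (cmap (atlas c) @` (U `&` cdom (atlas c))) y ->
       (g \o cinv (atlas c)) y = h y].
  by apply: sg; exists x.
have cc : {for x, continuous (cmap (atlas c))}.
  have cO := @cdom_open _ _ _ (atlas c).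
  have := @cmap_continuous _ _ _ (atlas c).
  by rewrite continuous_open_subspace//; apply; exact/mem_set.
have hc : {for x, continuous (h \o cmap (atlas c))}.
  by apply: continuous_comp => //; exact: Ch.
have gE y : U y -> cdom (atlas c) y -> W (cmap (atlas c) y) ->
    g y = h (cmap (atlas c) y).
  by move=> Uy cy Wy; rewrite -gh//= ?cmapK//; exists y.
rewrite /prop_for /continuous_at gE//; apply: cvg_trans hc.
apply: (@near_eq_cvg _ _ (nbhs x)); near=> y; rewrite /= gE//.
- by near: y; apply: open_nbhs_nbhs.
- by near: y; apply: open_nbhs_nbhs; split=> //; exact: cdom_open.
- by near: y; apply: cc; exact: open_nbhs_nbhs.
Unshelve. all: by end_near. Qed.

(** Compatibility of the atlas is what makes coordinates smooth in other charts. *)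
Lemma smooth_map_id : smooth_map (@id X).
Proof.
split=> [x //|c i c']; have := @atlas_compatible _ _ X c' c i.
by rewrite setIC.
Qed.

End SmoothGerms.

Lemma smooth_near_comp {R : realType} {m p : nat} {X : manifold R m}
    {Y : manifold R p} (f : X -> Y) (x : X) (g : Y -> R) :
  smooth_map f -> smooth_near (f x) g -> smooth_near x (g \o f).
Proof.
move=> [fc sf] [V [oV Vfx sg]]; have [c' c'fx] := atlas_cover (f x).
pose D := V `&` cdom (atlas c').
have oD : open D by apply: openI => //; exact: cdom_open.
exists (f @^-1` D); split=> //; first exact: open_comp.
move=> c.
have := sg c'.
have FB y : (cmap (atlas c) @` (f @^-1` D `&` cdom (atlas c))) y ->
    (cmap (atlas c') @` D) (cmap (atlas c') (f (cinv (atlas c) y))).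
  by move=> [z [Dz cz] <-]; rewrite cmapK//; exists (f z).
move/(smooth_in_comp _ FB) => sgf.
apply: (smooth_in_eq _ (sgf _)) => [_ [z [[Vz c'z] cz] <-]|j] /=.
  by rewrite !cmapK.
apply: smooth_in_subset (sf c' j c) => _ [z [[Vz c'z] cz] <-].
by exists z.
Qed.

(** * Frames, forms and their pullbacks *)

Lemma linear_lincomb {R : realType} {V W : lmodType R} (g : V -> W) n
    (c : 'I_n -> R) (e : 'I_n -> V) : linear g ->
  g (\sum_j c j *: e j) = \sum_j c j *: g (e j).
Proof.
move=> lg; pose gL : {linear V -> W} := HB.pack g (GRing.isLinear.Build _ _ _ _ g lg).
by rewrite -[g]/(gL : V -> W) linear_sum; apply: eq_bigr => j _; rewrite linearZ.
Qed.

Lemma linear_fun0 {R : realType} {V W : lmodType R} (g : V -> W) :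
  linear g -> g 0 = 0.
Proof.
by move=> /(linear_lincomb (n := 0) (fun=> 0) (fun=> 0)); rewrite !big_ord0.
Qed.

Lemma dfwithE {I : eqType} {T : Type} (a : I -> T) i u l :
  dfwith a i u l = if l == i then u else a l.
Proof.
case: eqP => [->|/eqP li]; first by rewrite dfwithin.
by rewrite dfwithout// eq_sym.
Qed.

Lemma comp_dfwith {I : eqType} {S T : Type} (g : S -> T) (a : I -> S) i u :
  (fun l => g (dfwith a i u l)) = dfwith (g \o a) i (g u).
Proof. by apply/funext => l; rewrite !dfwithE; case: ifP. Qed.

Section Forms.
Context {R : realType} {m : nat} {X : manifold R m} {r : nat}.
Variable E : vbundle X r.

Lemma frame_expansion t x (v : E x) : tdom t x ->
  v = \sum_i triv t v ord0 i *: frame t i x.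
Proof.
move=> tx; apply: (can_inj (trivK tx)).
rewrite (linear_lincomb _ _ (triv_linear tx)) [LHS]row_sum_delta.
by apply: eq_bigr => i _; rewrite trivVK.
Qed.

Lemma zero_is_form k : is_form (@zero_form _ _ _ _ E k).
Proof.
split=> [x a i s u w|//|t I]; first by rewrite /zero_form mulr0 addr0.
by move=> c; exact: smooth_in_cst.
Qed.

Lemma is_form_lincomb k (s : R) (omega theta : forall x, ('I_k -> E x) -> R) :
  is_form omega -> is_form theta ->
  is_form (fun x a => s * omega x a + theta x a).
Proof.
move=> [lo ao so] [lt at' st]; split=> [x a i c u w|x a i j ij aij|t I].
- by rewrite lo lt; ring.
- by rewrite (ao _ _ _ _ ij aij) (at' _ _ _ _ ij aij) mulr0 addr0.
- apply: near_smooth_on => x tx; have oT := tdom_open t.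
  apply: smooth_nearD; last exact: smooth_on_near (st t I) tx.
  by apply: smooth_nearM; [exact: smooth_near_cst|exact: smooth_on_near (so t I) tx].
Qed.

(** The slots are expanded in a frame one at a time: [n] bounds the slots that
    still hold an arbitrary section, the others hold frame vectors.  Sections
    along [f] are allowed so that the same lemma serves forms evaluated on
    sections ([f] the identity) and pullbacks. *)
Lemma smooth_near_form {p : nat} {Z : manifold R p} (f : Z -> X) k
    (omega : forall x, ('I_k -> E x) -> R) z t
    (s : 'I_k -> forall y, E (f y)) :
  smooth_map f -> is_form omega -> tdom t (f z) ->
  (forall l j, smooth_near z (fun y => triv t (s l y) ord0 j)) ->
  smooth_near z (fun y => omega (f y) (fun l => s l y)).
Proof.
move=> sf [lin _ smth] tz.
have near_t : \forall y \near z, tdom t (f y).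
  by apply: sf.1; apply: open_nbhs_nbhs; split=> //; exact: tdom_open.
suff expand n : forall s : 'I_k -> forall y, E (f y),
    (forall l j, smooth_near z (fun y => triv t (s l y) ord0 j)) ->
    (forall l : 'I_k, (n <= l)%N -> exists j, s l = fun y => frame t j (f y)) ->
    smooth_near z (fun y => omega (f y) (fun l => s l y)).
  move=> ss; apply: (expand k) => // l; by rewrite leqNgt ltn_ord.
elim: n => {s} [|n IH] s ss sn.
  have /choice[I sI] := fun l => sn l (leq0n l).
  have -> : (fun y => omega (f y) (fun l => s l y)) =
      (fun x => omega x (fun l => frame t (I l) x)) \o f.
    by apply/funext => y /=; congr omega; apply/funext => l; rewrite sI.
  apply: smooth_near_comp => //; apply: smooth_on_near (smth t I) tz.
  exact: tdom_open.
have [kn|nk] := leqP k n.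
  by apply: IH => // l nl; move: (ltn_ord l); rewrite ltnNge (leq_trans kn nl).
pose i := Ordinal nk.
pose s' j l := if l == i then fun y => frame t j (f y) else s l.
have ss' j : smooth_near z (fun y => omega (f y) (fun l => s' j l y)).
  apply: IH => [l j'|l nl]; rewrite /s'; case: eqP => [li|/eqP li].
  - apply: (smooth_near_eq _ (smooth_near_cst z (delta_mx ord0 j ord0 j' : R))).
    by apply: filterS near_t => y ty; rewrite trivVK.
  - exact: ss.
  - by exists j.
  - apply: sn; rewrite ltn_neqAle nl andbT.
    by apply: contra li => /eqP ni; apply/eqP/val_inj.
apply: (smooth_near_eq _ (smooth_near_sum (fun j => smooth_nearM (ss i j) (ss' j)))).
apply: filterS near_t => y ty.
have lin_i : linear (fun u => omega (f y) (dfwith (fun l => s l y) i u) : R^o).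
  by move=> c u w; rewrite lin.
have := linear_lincomb (fun j => triv t (s i y) ord0 j)
  (fun j => frame t j (f y)) lin_i.
rewrite -frame_expansion//.
have -> : dfwith (fun l => s l y) i (s i y) = (fun l => s l y).
  by apply/funext => l; rewrite dfwithE; case: eqP => // ->.
move=> ->; apply: eq_bigr => j _; congr (_ * omega _ _).
by apply/funext => l; rewrite dfwithE /s'; case: eqP.
Qed.

End Forms.

Section Pullback.
Context {R : realType} {m p : nat} {X : manifold R m} {Y : manifold R p}.
Context {r q : nat} (E : vbundle X r) (F : vbundle Y q).

(** Smoothness is local, and near [x] the vectors [phi (frame t i)] are sections
    along [f] whose coordinates in a frame of [F] are the matrix entries of
    [phi]. *)
Lemma pullback_is_form (f : X -> Y) (phi : forall x, E x -> F (f x)) k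
    (omega : forall y, ('I_k -> F y) -> R) :
  bundle_map phi -> is_form omega -> is_form (pullback phi omega).
Proof.
move=> [sf lphi sphi] fo; have [lin alt _] := fo.
split=> [x a i s u w|x a i j ij aij|t I]; rewrite /pullback.
- by rewrite !comp_dfwith lphi lin.
- by apply: alt ij _; rewrite aij.
- apply: near_smooth_on => x tx; have [t' t'x] := tdom_cover F (f x).
  apply: (smooth_near_form sf fo t'x) => l j.
  apply: smooth_on_near (sphi t t' (I l) j) _ => //.
  apply: openI; first exact: tdom_open.
  by apply: open_comp (tdom_open t') => y _; exact: sf.1.
Qed.

End Pullback.

(** * Linearity of the Koszul formula *)

Section Koszul.
Context {R : realType} {m : nat} {X : manifold R m} {r : nat}.
Variable A : lie_algebroid X r.

Lemma smooth_near_form_sections k I (omega : forall x, ('I_k -> A x) -> R)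
    (v : I -> forall x, A x) (s : seq I) x :
  is_form omega -> (forall i, smooth_section (v i)) ->
  smooth_near x (fun y => omega y (vec_of_seq [seq v l y | l <- s])).
Proof.
move=> fo sv; have [t tx] := tdom_cover A x.
apply: (smooth_near_form (s := fun l y => vec_of_seq [seq v l y | l <- s] l)
  smooth_map_id fo tx) => l j.
pose w y : A y := vec_of_seq [seq v l y | l <- s] l.
have sw : smooth_on (tdom t) (fun y => triv t (w y) ord0 j).
  have [ls|sl] := ltnP l (size s); last first.
    (* Past the end of [s] the slot holds the default value, the zero section. *)
    apply: (@smooth_on_eq _ _ _ _ (fun=> 0)) => [y ty|c]; last exact: smooth_in_cst.
    rewrite /w /vec_of_seq nth_default ?size_map//.
    by rewrite (linear_fun0 (triv_linear ty)) mxE.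
  case: s ls @w => // i0 s ls w.
  have -> : w = v (nth i0 (i0 :: s) l).
    by apply: functional_extensionality_dep => y; exact: nth_map.
  exact: sv.
exact: smooth_on_near (tdom_open t) sw tx.
Qed.

(** An anchor is linear on germs of smooth functions only, so distributing it
    relies on a form being smooth when evaluated on smooth sections. *)
Lemma koszul_lincomb k (s : R) (omega theta : forall x, ('I_k -> A x) -> R)
    (v : 'I_k.+1 -> forall x, A x) x :
  is_form omega -> is_form theta -> (forall i, smooth_section (v i)) ->
  koszul (fun x a => s * omega x a + theta x a) v x =
  s * koszul omega v x + koszul theta v x.
Proof.
move=> fo ft sv; rewrite /koszul mulrDr addrACA.
congr (_ + _); rewrite mulr_sumr -big_split; apply: eq_bigr => i _ /=.
  have [_ lin _] := anchor_tangent (v i x).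
  rewrite lin; [ring|exact: smooth_near_form_sections..].
rewrite mulr_sumr -big_split /=; apply: eq_bigr => j _; ring.
Qed.

Lemma closed_form_lincomb k (s : R) (omega theta : forall x, ('I_k -> A x) -> R) :
  is_form omega -> is_form theta -> closed_form omega -> closed_form theta ->
  closed_form (fun x a => s * omega x a + theta x a).
Proof.
move=> fo ft co ct v sv x; rewrite koszul_lincomb//.
by rewrite -co// -ct// /zero_form mulr0 addr0.
Qed.

End Koszul.

(** * Saddle-point matrices *)

Lemma mul_trmx_eq0 {F : fieldType} n (v : 'rV[F]_n) :
  (forall b : 'rV_n, (v *m b^T) ord0 ord0 = 0) -> v = 0.
Proof.
move=> v0; apply/rowP => j; have := v0 (delta_mx 0 j).
by rewrite trmx_delta -colE !mxE.
Qed.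

Section SaddlePoint.
Context {F : fieldType} {m q : nat}.
Variables (N : 'M[F]_m) (P : 'M[F]_(m, q)) (W : 'M[F]_q).

(** For [e != 0] the Schur complement of the block [- e] is [e^-1] times
    [e *: N + P *m W *m P^T]; unlike that complement, the matrix can remain
    invertible at [e = 0]. *)
Definition saddle_mx (e : F) : 'M[F]_(m + q) :=
  block_mx N (P *m W) P^T (- e)%:M.

(** If [(a, c)] is in the kernel, [a P W = 0] forces [a] into [ker P], and pairing
    [a N + c P^T = 0] with [ker P] kills the second term, so [a = 0] by
    nondegeneracy on [ker P]; then [c P^T = 0], and [c = 0] because [P] is onto. *)
Lemma saddle_mx0_unit : W \in unitmx ->
  (forall d : 'rV_q, exists a : 'rV_m, a *m P = d) ->
  (forall a : 'rV_m, a *m P = 0 ->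
     (forall b : 'rV_m, b *m P = 0 -> (a *m N *m b^T) ord0 ord0 = 0) -> a = 0) ->
  saddle_mx 0 \in unitmx.
Proof.
move=> uW surjP ndN; rewrite -row_free_unit; apply: inj_row_free => v.
rewrite -(hsubmxK v) mul_row_block oppr0 -scalemx1 scale0r mulmx0 addr0.
set a := lsubmx v; set c := rsubmx v.
rewrite -row_mx0 => /eq_row_mx[aNc aPW].
have aP : a *m P = 0.
  by rewrite -[a *m P](mulmxK uW) -(mulmxA a) aPW mul0mx.
have a0 : a = 0.
  apply: ndN => // b bP; rewrite (_ : a *m N = - (c *m P^T)).
    by rewrite mulNmx -mulmxA -trmx_mul bP trmx0 mulmx0 oppr0 mxE.
  by apply/eqP; rewrite -addr_eq0 aNc.
rewrite a0 (_ : c = 0) ?row_mx0//; apply: mul_trmx_eq0 => d.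
have [b <-] := surjP d; move: aNc; rewrite a0 mul0mx add0r => cP.
by rewrite trmx_mul mulmxA cP mul0mx mxE.
Qed.

(** [(e a, a P W)] is a kernel vector of the saddle-point matrix. *)
Lemma saddle_mx_nondegenerate e (a : 'rV_m) : e != 0 ->
  saddle_mx e \in unitmx -> a *m (e *: N + P *m W *m P^T) = 0 -> a = 0.
Proof.
move=> e0 uK aB.
have : row_mx (e *: a) (a *m P *m W) *m saddle_mx e = 0.
  rewrite mul_row_block -[RHS]row_mx0; congr row_mx.
    by rewrite -scalemxAl -aB mulmxDr -scalemxAr !mulmxA.
  by rewrite -scalemxAl mul_mx_scalar scaleNr !mulmxA subrr.
move/(congr1 (mulmx^~ (invmx (saddle_mx e)))); rewrite mulmxK// mul0mx -row_mx0.
by move=> /eq_row_mx[/eqP]; rewrite scaler_eq0 (negPf e0) => /eqP.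
Qed.

End SaddlePoint.

Lemma cvg_det {R : realType} {T : Type} (F : set_system T) {FF : Filter F} n
    (M : T -> 'M[R]_n) (M0 : 'M[R]_n) :
  (forall i j, M z i j @[z --> F] --> M0 i j) ->
  \det (M z) @[z --> F] --> \det M0.
Proof.
move=> MM0; rewrite /determinant.
apply: cvg_big => [|s _]; first exact: add_continuous.
apply: cvgM; first exact: cvg_cst.
by apply: cvg_big => [|i _]; [exact: mul_continuous|exact: MM0].
Qed.

(** * Gram matrices of two-forms *)

Section Gram.
Context {R : realType} {m : nat} {X : manifold R m} {r : nat}.
Variable E : vbundle X r.
Implicit Types omega : forall x, ('I_2 -> E x) -> R.

Definition gram omega t x : 'M[R]_r :=
  \matrix_(i, j) omega x (vec_of_seq [:: frame t i x; frame t j x]).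

Lemma form_gram omega t x (u w : E x) : is_form omega -> tdom t x ->
  omega x (vec_of_seq [:: u; w]) =
  (triv t u *m gram omega t x *m (triv t w)^T) ord0 ord0.
Proof.
move=> [lin _ _] tx.
have slot0 (u0 u1 w1 : E x) : vec_of_seq [:: u1; w1] =
    dfwith (vec_of_seq (k := 2) [:: u0; w1]) ord0 u1.
  by apply/funext; case=> [[|[|//]] ?]; rewrite dfwithE.
have slot1 (u1 w0 w1 : E x) : vec_of_seq [:: u1; w1] =
    dfwith (vec_of_seq (k := 2) [:: u1; w0]) ord_max w1.
  by apply/funext; case=> [[|[|//]] ?]; rewrite dfwithE.
have lin0 w1 : linear (fun u1 => omega x (vec_of_seq [:: u1; w1]) : R^o).
  by move=> c u1 u2; rewrite (slot0 0) lin -!slot0.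
have lin1 u1 : linear (fun w1 => omega x (vec_of_seq [:: u1; w1]) : R^o).
  by move=> c w1 w2; rewrite (slot1 _ 0) lin -!slot1.
rewrite {1}(frame_expansion u tx) {1}(frame_expansion w tx).
rewrite (linear_lincomb _ _ (lin0 _)) -mulmxA mxE; apply: eq_bigr => i _.
rewrite (linear_lincomb _ _ (lin1 _)) mxE; congr (_ * _).
by apply: eq_bigr => j _; rewrite !mxE mulrC.
Qed.

Lemma gram_smooth omega t x i j : is_form omega -> tdom t x ->
  smooth_near x (fun y => gram omega t y i j).
Proof.
move=> [_ _ smth] tx.
pose I (l : 'I_2) := nth i [:: i; j] l.
rewrite (_ : (fun y => _) = fun y => omega y (fun l => frame t (I l) y)).
  exact: smooth_on_near (tdom_open t) (smth t I) tx.
apply/funext => y; rewrite mxE; congr omega; apply/funext.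
by case=> [[|[|//]] lt2].
Qed.

Lemma gram_unit omega t x : is_form omega -> tdom t x ->
  nondegenerate_on setT (omega x) -> gram omega t x \in unitmx.
Proof.
move=> fo tx nd; rewrite -row_free_unit; apply: inj_row_free => d dG.
rewrite -[d](trivVK tx) (nd (trivV t x d))//.
  exact: linear_fun0 (triv_linear tx).
by move=> w _; rewrite (form_gram _ _ fo tx) trivVK// dG mul0mx mxE.
Qed.

End Gram.

(** * Nondegeneracy for small parameters *)

Section Fibration.
Context {R : realType} {m p : nat} {X : manifold R m} {Y : manifold R p}.
Context {r q : nat}.

Section BundleMap.
Variables (E : vbundle X r) (F : vbundle Y q) (f : X -> Y).
Variable phi : forall x, E x -> F (f x).
Hypothesis bphi : bundle_map phi.

Definition map_matrix (t : triv_idx E) (t' : triv_idx F) x : 'M[R]_(r, q) :=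
  \matrix_(i, j) triv t' (phi (frame t i x)) ord0 j.

Lemma triv_map t t' x (u : E x) : tdom t x -> tdom t' (f x) ->
  triv t' (phi u) = triv t u *m map_matrix t t' x.
Proof.
move=> tx t'x; have [_ lphi _] := bphi.
rewrite {1}(frame_expansion u tx) (linear_lincomb _ _ (lphi x)).
rewrite (linear_lincomb _ _ (triv_linear t'x)).
apply/rowP => j; rewrite !mxE summxE; apply: eq_bigr => i _.
by rewrite !mxE.
Qed.

Lemma map_matrix_smooth t t' x i j : tdom t x -> tdom t' (f x) ->
  smooth_near x (fun y => map_matrix t t' y i j).
Proof.
move=> tx t'x; have [[fc _] _ sphi] := bphi.
under eq_fun do rewrite mxE.
apply: smooth_on_near (sphi t t' i j) _ => //.
apply: openI; first exact: tdom_open.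
by apply: open_comp (tdom_open t') => y _; exact: fc.
Qed.

(** Openness of invertibility, applied to the saddle-point matrix at [(x0, 0)];
    the limit [e = 0] itself is excluded by taking [e] to the right of [0]. *)
Lemma near_nondegenerate (eta : forall x, ('I_2 -> E x) -> R)
    (omega : forall y, ('I_2 -> F y) -> R) x0 :
  is_form eta -> is_form omega ->
  (forall b : F (f x0), exists a, phi a = b) ->
  nondegenerate_on setT (omega (f x0)) ->
  nondegenerate_on [set a | phi a = 0] (eta x0) ->
  \forall x \near x0 & e \near 0^'+,
    nondegenerate_on setT (fun a => e * eta x a + pullback phi omega a).
Proof.
move=> feta fom surj nd_om nd_eta; have [sf lphi _] := bphi.
have [t tx0] := tdom_cover E x0; have [t' t'x0] := tdom_cover F (f x0).
pose N x := gram eta t x; pose P x := map_matrix t t' x.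
pose W x := gram omega t' (f x).
have uK0 : saddle_mx (N x0) (P x0) (W x0) 0 \in unitmx.
  apply: saddle_mx0_unit => [|d|a aP ndN].
  - exact: gram_unit.
  - have [a phia] := surj (trivV t' (f x0) d).
    by exists (triv t a); rewrite -(triv_map _ tx0 t'x0) phia trivVK.
  - rewrite -[a](trivVK tx0) (nd_eta (trivV t x0 a)).
    + exact: linear_fun0 (triv_linear tx0).
    + apply: (can_inj (trivK t'x0)); rewrite (triv_map _ tx0 t'x0) trivVK// aP.
      exact/esym/linear_fun0/triv_linear.
    + move=> w /= phiw; rewrite (form_gram _ _ feta tx0) trivVK//.
      apply: ndN; rewrite -(triv_map _ tx0 t'x0) phiw.
      exact: linear_fun0 (triv_linear t'x0).
have cN i j : {for x0, continuous (fun x => N x i j)}.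
  exact/smooth_near_continuous/gram_smooth.
have sP i j : smooth_near x0 (fun x => P x i j) by exact: map_matrix_smooth.
have sW i j : smooth_near x0 (fun x => W x i j).
  apply: (smooth_near_comp sf (g := fun y => gram omega t' y i j)).
  exact: gram_smooth.
have cPW i j : {for x0, continuous (fun x => (P x *m W x) i j)}.
  apply: smooth_near_continuous; under eq_fun do rewrite mxE.
  by apply: smooth_near_sum => k; exact: smooth_nearM.
have cK : \det (saddle_mx (N z.1) (P z.1) (W z.1) z.2)
    @[z --> (nbhs x0, 0^'+)] --> \det (saddle_mx (N x0) (P x0) (W x0) 0).
  have cx (g : X -> R) : {for x0, continuous g} ->
      g z.1 @[z --> (nbhs x0, (0:R)^'+)] --> g x0.
    by move=> gc; exact: (cvg_comp fst g cvg_fst gc).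
  have c2 : z.2 @[z --> (nbhs x0, (0:R)^'+)] --> (0:R).
    exact: cvg_trans cvg_snd (cvg_within _).
  apply: cvg_det => i j.
  case: (split_ordP i) => i' ->; case: (split_ordP j) => j' ->.
  - rewrite block_mxEul; under eq_fun do rewrite block_mxEul.
    exact: cx (cN i' j').
  - rewrite block_mxEur; under eq_fun do rewrite block_mxEur.
    exact: cx (cPW i' j').
  - rewrite block_mxEdl mxE; under eq_fun do rewrite block_mxEdl mxE.
    exact: cx (smooth_near_continuous (sP j' i')).
  - rewrite block_mxEdr mxE; under eq_fun do rewrite block_mxEdr mxE.
    by apply: cvgMn; apply: cvgN; exact: c2.
have nearK : \forall z \near (nbhs x0, (0:R)^'+),
    \det (saddle_mx (N z.1) (P z.1) (W z.1) z.2) != 0.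
  have detK0 : \det (saddle_mx (N x0) (P x0) (W x0) 0) != 0.
    by rewrite -unitfE -unitmxE.
  exact: (cvgr_neq0 _ cK detK0).
have near_t : \forall z \near (nbhs x0, (0:R)^'+), tdom t z.1 /\ tdom t' (f z.1).
  have nt : \forall x \near x0, tdom t x /\ tdom t' (f x).
    apply: filterI; first by apply: open_nbhs_nbhs; split=> //; exact: tdom_open.
    by apply: sf.1; apply: open_nbhs_nbhs; split=> //; exact: tdom_open.
  exact: (cvg_fst nt).
have near_e : \forall z \near (nbhs x0, (0:R)^'+), 0 < z.2.
  have ne : \forall e \near (0:R)^'+, 0 < e by exact: nbhs_right_gt.
  exact: (cvg_snd ne).
apply: filterS (filterI nearK (filterI near_e near_t)).
move=> [x e] /= [K0 [e0 [tx t'x]]] u _ uw.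
have uK : saddle_mx (N x) (P x) (W x) e \in unitmx by rewrite unitmxE unitfE.
rewrite (can_inj (trivK tx) (_ : triv t u = triv t 0))//.
rewrite (linear_fun0 (triv_linear tx)).
apply: (saddle_mx_nondegenerate (lt0r_neq0 e0) uK).
apply: mul_trmx_eq0 => b; rewrite -[b](trivVK tx) -(uw (trivV t x b))//.
rewrite /pullback (form_gram _ _ feta tx).
rewrite (_ : (fun i => _) = vec_of_seq [:: phi u; phi (trivV t x b)]).
  rewrite (form_gram _ _ fom t'x) !(triv_map _ tx t'x) trmx_mul.
  by rewrite mulmxDr mulmxDl -scalemxAr -scalemxAl !mulmxA !mxE.
by apply/funext; case=> [[|[|//]] ?].
Qed.

End BundleMap.
End Fibration.

(** Compactness of [X] turns the bounds on [e] near each point into one value of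
    [e] that works everywhere. *)
Theorem compact_fibration_symplectic {R : realType} {m p r q : nat}
  {X : manifold R m} {Y : manifold R p} (AX : lie_algebroid X r)
  (AY : lie_algebroid Y q) (f : X -> Y) (phi : forall x, AX x -> AY (f x))
  (eta : forall x, ('I_2 -> AX x) -> R) :
  compact [set: X] -> algebroid_fibration phi -> admits_symplectic AY ->
  is_form eta -> closed_form eta ->
  (forall x, nondegenerate_on [set a | phi x a = 0] (eta x)) ->
  admits_symplectic AX.
Proof.
move=> cptX [[bphi chain] surj] [omega [fom com ndom]] feta ceta ndeta.
have fpull := pullback_is_form bphi fom.
have cpull : closed_form (A := AX) (pullback phi omega).
  exact: (chain _ _ _ fom (zero_is_form AY 3) com).
have cover x : [set: X] x -> \forall x' \near x & e \near 0^'+,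
    nondegenerate_on setT (fun a => e * eta x' a + pullback phi omega a).
  by move=> _; apply: near_nondegenerate.
have near_e : \forall e \near (0:R)^'+, [set: X] `<=`
    [set x | nondegenerate_on setT
      (fun a : 'I_2 -> AX x => e * eta x a + pullback phi omega a)].
  exact: (compact_near_coveringP _).1 cptX _ _ _ _ cover.
have [e nde] := filter_ex near_e.
exists (fun x a => e * eta x a + pullback phi omega a); split.
- exact: is_form_lincomb.
- exact: closed_form_lincomb.
- by move=> x; exact: nde.
Qed.

Theorem theorem4p5 (R : realType) (mX mY n : nat) (hn : (1 <= n)%N)
  (X : manifold R mX) (Y : manifold R mY)
  (oX : orientable X) (oY : orientable Y)
  (cptX : compact [set: X]) (cptY : compact [set: Y])
  (connX : connected [set: X]) (connY : connected [set: Y])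
  (AX : lie_algebroid X (2 * n)) (AY : lie_algebroid Y (2 * n - 2))
  (f : X -> Y) (phi : forall x, AX x -> AY (f x))
  (hfib : algebroid_fibration phi)
  (hY : admits_symplectic AY)
  (heta : exists eta : forall x, ('I_2 -> AX x) -> R,
    [/\ is_form eta, closed_form eta &
        forall x, nondegenerate_on [set a | phi x a = 0] (eta x)]) :
  admits_symplectic AX.
Proof.
have [eta [feta ceta ndeta]] := heta.
exact: (compact_fibration_symplectic cptX hfib hY feta ceta ndeta).
Qed.
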